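(* Let $f:\mathbb{R}^n\to\mathbb{R}$ be a weak uniform CN function with CN form $f=[g:g_1,\dots,g_r]$, and let $(\bm x^*,\bm y^* )\in X(f)$. Consider the problem $(\mathrm{WCNP1})(\bm x^*,\bm y^* )$: minimize $$G_1(\bm x,\bm y)=\nabla g(\bm x^*,\bm y^* )^\top[(\bm x,\bm y)-(\bm x^*,\bm y^* )]+\tfrac12[(\bm x,\bm y)-(\bm x^*,\bm y^* )]^\top B(\bm x^*,\bm y^* )[(\bm x,\bm y)-(\bm x^*,\bm y^* )]$$ subject to $(\bm x,\bm y)\in T_1(\bm x^*,\bm y^* )$. If the objective value $G_1(\bm x,\bm y)$ of $(\mathrm{WCNP1})(\bm x^*,\bm y^* )$ has a lower bound (on its feasible set), then there is an optimal solution $(\bar{\bm x},\bar{\bm y})$ to $(\mathrm{WCNP1})(\bm x^*,\bm y^* )$. Furthermore, put $\bar{\bm d}=(\bar{\bm x},\bar{\bm y})-(\bm x^*,\bm y^* )$. If $G_1(\bar{\bm x},\bar{\bm y})\ge0$, then $(\bm x^*,\bm y^* )$ is an optimal solution to (CNP) and $\bm x^*$ is an optimal solution to (CNO); if $G_1(\bar{\bm x},\bar{\bm y})<0$, then $G_1(\bar{\bm x},\bar{\bm y})=-\frac12\bar{\bm d}^\top B(\bm x^*,\bm y^* )\bar{\bm d}$. If there is $(\bm x',\bm y')$ such that $\nabla g_i(\bm x^*,\bm y^* )^\top[(\bm x',\bm y')-(\bm x^*,\bm y^* )]<0$ for $i=1,\dots,r$, then there are $\alpha_i^*\ge0$, $i=1,\dots,r$,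 such that $$B(\bm x^*,\bm y^* )\bar{\bm d}+\nabla g(\bm x^*,\bm y^* )+\sum_{i=1}^r\alpha_i^*\nabla g_i(\bm x^*,\bm y^* )=0.$$
   Context: Let $f:\mathbb{R}^n\to\mathbb{R}$ be nonconvex and let $g,g_1,\dots,g_r:\mathbb{R}^n\times\mathbb{R}^m\to\mathbb{R}$ ($r\ge1$) be convex. Put $X(\bm g)=\{(\bm x,\bm y)\in\mathbb{R}^n\times\mathbb{R}^m: g_i(\bm x,\bm y)=0,\ i=1,\dots,r\}$. The function $f$ is a CN (convertible nonconvex) function with CN form $f=[g:g_1,\dots,g_r]$ if for each $\bm x\in\mathbb{R}^n$ there is $\bm y\in\mathbb{R}^m$ with $(\bm x,\bm y)\in X(\bm g)$ and $f(\bm x)=g(\bm x,\bm y)=\min_{(\bm x,\bm y')\in X(\bm g)}g(\bm x,\bm y')$. Put $X(f)=\{(\bm x,\bm y)\in X(\bm g): f(\bm x)=g(\bm x,\bm y)\}$. $f$ is a weak uniform CN function if moreover $g$ is weak uniform convex: for every $(\bm x,\bm y)$ there is a positive semidefinite (symmetric) matrix $B(\bm x,\bm y)$ such that $g((\bm x,\bm y)+\bm d)-g(\bm x,\bm y)\ge\nabla g(\bm x,\bm y)^\top\bm d+\frac12\bm d^\top B(\bm x,\bm y)\bm d$ for all $\bm d\in\mathbb{R}^n\times\mathbb{R}^m$; such a $B$ is fixed. Standing assumption: $g,g_1,\dots,g_r$ are twice differentiable ($f$ need not be differentiable). (CNO): $\min f(\bm x)$ s.t. $\bm x\in\mathbb{R}^n$.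 (CNP): $\min g(\bm x,\bm y)$ s.t. $(\bm x,\bm y)\in\mathbb{R}^n\times\mathbb{R}^m$, $g_i(\bm x,\bm y)=0$, $i=1,\dots,r$. ''Optimal solution'' means global minimizer. $T_1(\bm x^*,\bm y^* )=\{(\bm x,\bm y):\nabla g_i(\bm x^*,\bm y^* )^\top[(\bm x,\bm y)-(\bm x^*,\bm y^* )]\le0,\ i=1,\dots,r\}$. *)

(* Defs.v *)
From HB Require Import structures.
From mathcomp Require Import all_boot all_order all_algebra.
From mathcomp Require Import all_classical all_reals all_analysis.

Set Implicit Arguments.
Unset Strict Implicit.
Unset Printing Implicit Defensive.

Import Order.TTheory GRing.Theory Num.Theory.
Import numFieldNormedType.Exports.

Local Open Scope classical_set_scope.
Local Open Scope ring_scope.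

(* Vectors are columns; a point (x, y) of R^n x R^m is [col_mx x y], an
   element of R^(n + m). *)

Definition dotmul (R : realType) (k : nat) (u v : 'cV[R]_k) : R :=
  (u^T *m v) 0 0.

Definition quadform (R : realType) (k : nat) (A : 'M[R]_k) (d : 'cV[R]_k) : R :=
  (d^T *m A *m d) 0 0.

Definition psdmx (R : realType) (k : nat) (A : 'M[R]_k) : Prop :=
  A \is symmetricmx /\ forall d : 'cV[R]_k, 0 <= quadform A d.

(* The library only has the Jacobian of maps between spaces of row vectors. *)
Definition grad (R : realType) (k : nat) (h : 'cV[R]_k -> R) (z : 'cV[R]_k) :
    'cV[R]_k :=
  \col_i 'D_(delta_mx i 0) h z.

Definition twice_differentiable (R : realType) (k : nat) (h : 'cV[R]_k -> R) :
    Prop :=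
  (forall z : 'cV[R]_k, differentiable h z) /\
  (forall z : 'cV[R]_k, differentiable (grad h) z).

Definition optimal_solution (R : realType) (T : Type) (S : set T) (h : T -> R)
    (z : T) : Prop :=
  S z /\ forall w : T, S w -> h z <= h w.

(* X(g) *)
Definition Xg (R : realType) (k r : nat) (gs : 'I_r -> 'cV[R]_k -> R) :
    set 'cV[R]_k :=
  [set z | forall i : 'I_r, gs i z = 0].

Definition CN_function (R : realType) (n m r : nat) (f : 'cV[R]_n -> R)
    (g : 'cV[R]_(n + m) -> R) (gs : 'I_r -> 'cV[R]_(n + m) -> R) : Prop :=
  [/\ ~ convex_function setT f,
      convex_function setT g,
      forall i : 'I_r, convex_function setT (gs i)
    & forall x : 'cV[R]_n, exists y : 'cV[R]_m,
        optimal_solution [set y' : 'cV[R]_m | Xg gs (col_mx x y')]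
          (fun y' => g (col_mx x y')) y /\
        f x = g (col_mx x y)].

(* X(f) *)
Definition Xf (R : realType) (n m r : nat) (f : 'cV[R]_n -> R)
    (g : 'cV[R]_(n + m) -> R) (gs : 'I_r -> 'cV[R]_(n + m) -> R) :
    set ('cV[R]_n * 'cV[R]_m) :=
  [set p | Xg gs (col_mx p.1 p.2) /\ f p.1 = g (col_mx p.1 p.2)].

Definition weak_uniform_convex (R : realType) (k : nat) (g : 'cV[R]_k -> R)
    (B : 'cV[R]_k -> 'M[R]_k) : Prop :=
  forall z : 'cV[R]_k, psdmx (B z) /\
    forall d : 'cV[R]_k,
      g (z + d) - g z >= dotmul (grad g z) d + 2^-1 * quadform (B z) d.

Definition weak_uniform_CN (R : realType) (n m r : nat) (f : 'cV[R]_n -> R)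
    (g : 'cV[R]_(n + m) -> R) (gs : 'I_r -> 'cV[R]_(n + m) -> R)
    (B : 'cV[R]_(n + m) -> 'M[R]_(n + m)) : Prop :=
  CN_function f g gs /\ weak_uniform_convex g B.

Definition T1 (R : realType) (k r : nat) (gs : 'I_r -> 'cV[R]_k -> R)
    (zs : 'cV[R]_k) : set 'cV[R]_k :=
  [set z | forall i : 'I_r, dotmul (grad (gs i) zs) (z - zs) <= 0].

Definition G1 (R : realType) (k : nat) (g : 'cV[R]_k -> R)
    (B : 'cV[R]_k -> 'M[R]_k) (zs z : 'cV[R]_k) : R :=
  dotmul (grad g zs) (z - zs) + 2^-1 * quadform (B zs) (z - zs).

(* Main.v *)
Require Import Defs.
From HB Require Import structures.
From mathcomp Require Import all_boot all_order all_algebra.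
From mathcomp Require Import ring lra.
From mathcomp Require Import all_classical all_reals all_analysis.
Import Order.TTheory GRing.Theory Num.Theory.
Import numFieldNormedType.Exports.
Local Open Scope classical_set_scope.
Local Open Scope ring_scope.

(** Write d = z - zs. The feasible set of the model problem becomes the
    polyhedral cone C cut out by the constraint gradients at zs, and its
    objective becomes the convex quadratic q(d) = c.d + d.Bd / 2 with
    c = grad g zs, which vanishes at d = 0.

    Existence. A convex quadratic bounded below on a polyhedral cone attains
    its minimum there ([quadobj_polycone_min], a case of the Frank-Wolfe
    theorem). The proof is algebraic, by induction on the number of
    inequalities. Drop an inequality a.d <= 0. If q is still bounded below and
    its minimizer on the larger cone satisfies a.d <= 0, that minimizer is the
    answer. Otherwise every point x of the original cone can be joined to a
    point y of the larger cone with a.y > 0 and q(y) <= q(x): the violating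
    minimizer, or, when q is unbounded below, any point where q lies under its
    bound on the original cone. The segment from x to y crosses the hyperplane
    a.d = 0, and by convexity q is at most q(x) at the crossing. Hence it
    suffices to minimize over the face a.d = 0, which a linear substitution
    turns into a problem of the same kind with one inequality fewer. With no
    inequality left, boundedness forces c to be orthogonal to ker B, that is
    c = Be, and -e is a minimizer.

    Optimality conditions. At a minimizer d of q on C the gradient p = c + Bd
    satisfies p.w >= 0 for w in C, and p.d = 0 because C contains the whole ray
    through d ([quadobj_polycone_stationary]). From c.d + d.Bd = 0 the minimal
    value is -d.Bd / 2. From the first condition, Farkas' lemma ([farkas])
    gives the multipliers. Farkas' lemma is itself a consequence of the two
    preceding results, applied to the squared distance from -p to the cone
    spanned by the constraint gradients.

    Optimality for the original problems. The gradient inequality for the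
    convex g_i shows that every w with g_i(w) = 0 is feasible for the model
    ([convex_gradient_ineq]), and weak uniform convexity says that
    g(w) - g(zs) is at least the value of the model at w. So a nonnegative
    minimum of the model makes zs a global minimizer of g on X(g), and then xs
    minimizes f, whose values are all values of g on X(g). *)

(** * Euclidean inner product and positive semidefinite forms *)

Lemma dotmulE {R : realType} {k} (u v : 'cV[R]_k) :
  dotmul u v = \sum_i u i 0 * v i 0.
Proof. by rewrite /dotmul mxE; apply: eq_bigr => i _; rewrite mxE. Qed.

Lemma dotmulC {R : realType} {k} (u v : 'cV[R]_k) : dotmul u v = dotmul v u.
Proof. by rewrite !dotmulE; apply: eq_bigr => i _; rewrite mulrC. Qed.

Lemma dotmulDr {R : realType} {k} (u v w : 'cV[R]_k) :
  dotmul u (v + w) = dotmul u v + dotmul u w.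
Proof. by rewrite /dotmul mulmxDr mxE. Qed.

Lemma dotmulZr {R : realType} {k} (u v : 'cV[R]_k) (t : R) :
  dotmul u (t *: v) = t * dotmul u v.
Proof. by rewrite /dotmul -scalemxAr mxE. Qed.

Lemma dotmulNr {R : realType} {k} (u v : 'cV[R]_k) :
  dotmul u (- v) = - dotmul u v.
Proof. by rewrite /dotmul mulmxN mxE. Qed.

Lemma dotmulBr {R : realType} {k} (u v w : 'cV[R]_k) :
  dotmul u (v - w) = dotmul u v - dotmul u w.
Proof. by rewrite dotmulDr dotmulNr. Qed.

Lemma dotmulDl {R : realType} {k} (u v w : 'cV[R]_k) :
  dotmul (u + v) w = dotmul u w + dotmul v w.
Proof. by rewrite !(dotmulC _ w) dotmulDr. Qed.

Lemma dotmulZl {R : realType} {k} (u v : 'cV[R]_k) (t : R) :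
  dotmul (t *: u) v = t * dotmul u v.
Proof. by rewrite !(dotmulC _ v) dotmulZr. Qed.

Lemma dotmul_mulmxl {R : realType} {k l} (A : 'M[R]_(k, l)) u (v : 'cV[R]_k) :
  dotmul (A *m u) v = dotmul u (A^T *m v).
Proof. by rewrite /dotmul trmx_mul mulmxA. Qed.

Lemma dotmul_delta {R : realType} {k} (u : 'cV[R]_k) i :
  dotmul u (delta_mx i 0) = u i 0.
Proof. by rewrite /dotmul -colE !mxE. Qed.

Lemma dotmul_ge0 {R : realType} {k} (u : 'cV[R]_k) : 0 <= dotmul u u.
Proof. by rewrite dotmulE sumr_ge0 // => i _; rewrite -expr2 sqr_ge0. Qed.

Lemma dotmul_le0_eq0 {R : realType} {k} (u : 'cV[R]_k) :
  dotmul u u <= 0 -> u = 0.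
Proof.
move=> uu_le0; have /eqP : dotmul u u = 0.
  by apply/eqP; rewrite eq_le uu_le0 dotmul_ge0.
rewrite dotmulE psumr_eq0 => [/allP u0|i _]; last by rewrite -expr2 sqr_ge0.
apply/colP => i; rewrite mxE; apply/eqP.
by have := u0 i (mem_index_enum _); rewrite -expr2 sqrf_eq0.
Qed.

Lemma quadformE {R : realType} {k} (B : 'M[R]_k) d :
  quadform B d = dotmul d (B *m d).
Proof. by rewrite /quadform /dotmul mulmxA. Qed.

Lemma psdmx_tr {R : realType} {k} (B : 'M[R]_k) : psdmx B -> B^T = B.
Proof.
by case=> /is_hermitianmxP; rewrite expr0 scale1r map_mx_id // => <-.
Qed.

Lemma psdmx_congr {R : realType} {k l} (B : 'M[R]_k) (K : 'M[R]_(k, l)) :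
  psdmx B -> psdmx (K^T *m B *m K).
Proof.
move=> Bpsd; split.
  apply/is_hermitianmxP; rewrite expr0 scale1r map_mx_id //.
  by rewrite !trmx_mul trmxK (psdmx_tr _ Bpsd) mulmxA.
move=> d; have := Bpsd.2 (K *m d).
by rewrite !quadformE dotmul_mulmxl !mulmxA.
Qed.

Lemma psdmx_gram {R : realType} {k l} (M : 'M[R]_(k, l)) : psdmx (M^T *m M).
Proof.
split; last by move=> d; rewrite quadformE -mulmxA -dotmul_mulmxl dotmul_ge0.
by apply/is_hermitianmxP; rewrite expr0 scale1r map_mx_id // trmx_mul trmxK.
Qed.

(** * Convex quadratic functions *)
Definition quadobj {R : realType} {k} (c : 'cV[R]_k) (B : 'M[R]_k)
    (d : 'cV[R]_k) : R :=
  dotmul c d + 2^-1 * quadform B d.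

Lemma quadobjD {R : realType} {k} (c : 'cV[R]_k) (B : 'M[R]_k) d w :
  B^T = B ->
  quadobj c B (d + w) =
    quadobj c B d + dotmul (c + B *m d) w + 2^-1 * quadform B w.
Proof.
move=> Bsym; rewrite /quadobj !quadformE mulmxDr !dotmulDr.
rewrite !dotmulDl dotmul_mulmxl Bsym (dotmulC w (B *m d)) dotmul_mulmxl Bsym.
by field.
Qed.

Lemma quadobj_line {R : realType} {k} (c : 'cV[R]_k) (B : 'M[R]_k) d w (t : R) :
  B^T = B ->
  quadobj c B (d + t *: w) =
    quadobj c B d + t * dotmul (c + B *m d) w + 2^-1 * t ^+ 2 * quadform B w.
Proof.
move=> Bsym; rewrite quadobjD // dotmulZr !quadformE -scalemxAr.
by rewrite dotmulZl dotmulZr; field.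
Qed.

Lemma quadobj_convex {R : realType} {k} (c : 'cV[R]_k) (B : 'M[R]_k) x y
    (t : R) :
  psdmx B -> 0 <= t <= 1 -> quadobj c B y <= quadobj c B x ->
  quadobj c B (x + t *: (y - x)) <= quadobj c B x.
Proof.
move=> Bpsd /andP[t0 t1] yx.
have yE : quadobj c B y = quadobj c B (x + 1 *: (y - x)).
  by rewrite scale1r addrC subrK.
move: yx; rewrite yE !quadobj_line; try exact: psdmx_tr.
have := Bpsd.2 (y - x).
move: (quadform _ _) (dotmul _ _) (quadobj c B x) => b a q b0.
rewrite -!addrA !gerDl => ab.
have : t * (t * b) <= t * b by apply: ler_wpM2l => //; apply: ler_piMl.
have : t * (1 * a + 2^-1 * 1 ^+ 2 * b) <= 0 by apply: mulr_ge0_le0.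
by rewrite !expr2; lra.
Qed.

Lemma quadobj_mulmx {R : realType} {k l} (c : 'cV[R]_k) (B : 'M[R]_k)
    (K : 'M[R]_(k, l)) u :
  quadobj c B (K *m u) = quadobj (K^T *m c) (K^T *m B *m K) u.
Proof.
rewrite /quadobj !quadformE; congr (_ + _ * _).
  by rewrite dotmul_mulmxl trmxK.
by rewrite dotmul_mulmxl !mulmxA.
Qed.

(** The increment of the quadratic along w is t * a + t ^+ 2 * b / 2, where a is
    the directional derivative; if a were negative, the linear term would win
    for small t. *)
Lemma quadobj_stationary {R : realType} {k} (c : 'cV[R]_k) (B : 'M[R]_k) d w :
  B^T = B ->
  (forall t, 0 < t <= 1 -> quadobj c B d <= quadobj c B (d + t *: w)) ->
  0 <= dotmul (c + B *m d) w.
Proof.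
move=> Bsym dmin; rewrite leNgt; apply/negP => a_lt0.
have {dmin} H t : 0 < t <= 1 ->
    0 <= dotmul (c + B *m d) w + 2^-1 * t * quadform B w.
  move=> t01; have /andP[t0 _] := t01.
  have := dmin t t01; rewrite quadobj_line // -addrA lerDl expr2.
  set a := dotmul _ _; set b := quadform _ _.
  by rewrite (_ : _ + _ = t * (a + 2^-1 * t * b)) ?pmulr_rge0 //; field.
move: H a_lt0; move: (dotmul _ _) (quadform _ _) => a b H a_lt0.
(* The step t = - a / (`|b| - a) lies in ]0, 1] whatever the sign of b, and
   t * b <= - a, so that a + t * b / 2 <= a / 2 < 0. *)
have den0 : 0 < `|b| - a by have := normr_ge0 b; lra.
have := H (- a / (`|b| - a)); rewrite divr_gt0 ?oppr_gt0 //=.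
rewrite ler_pdivrMr // mul1r lerDr normr_ge0 => /(_ isT).
set t := - a / _ => Ht.
have t0 : 0 < t by rewrite divr_gt0 // oppr_gt0.
have : t * b <= - a.
  have -> : - a = t * (`|b| - a) by rewrite divfK // gt_eqF.
  by apply: ler_wpM2l; [exact: ltW | have := ler_norm b; lra].
by lra.
Qed.

(** * Attainment of the minimum on a polyhedral cone *)
(** Listing the normals in a sequence, rather than as the rows of a matrix, lets
    inequalities be dropped one at a time. *)
Definition polycone {R : realType} {k} (s : seq 'cV[R]_k) : set 'cV[R]_k :=
  [set d | forall a, a \in s -> dotmul a d <= 0].

Lemma polycone_cons {R : realType} {k} (a : 'cV[R]_k) s d :
  polycone (a :: s) d <-> dotmul a d <= 0 /\ polycone s d.
Proof.
split=> [ds|[da ds] b]; last by rewrite inE => /orP[/eqP->|/ds].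
by split=> [|b bs]; apply: ds; rewrite inE ?eqxx ?bs ?orbT.
Qed.

Lemma polycone_segment {R : realType} {k} (s : seq 'cV[R]_k) x y (t : R) :
  0 <= t <= 1 -> polycone s x -> polycone s y ->
  polycone s (x + t *: (y - x)).
Proof.
move=> /andP[t0 t1] sx sy a sa; rewrite dotmulDr dotmulZr dotmulBr.
have := mulr_ge0_le0 t0 (sy a sa).
have : (1 - t) * dotmul a x <= 0 by rewrite mulr_ge0_le0 ?sx // subr_ge0.
by lra.
Qed.

Lemma polycone_ray {R : realType} {k} (s : seq 'cV[R]_k) d w (t : R) :
  0 <= t -> polycone s d -> polycone s w -> polycone s (d + t *: w).
Proof.
move=> t0 sd sw a sa; rewrite dotmulDr dotmulZr.
by have := sd a sa; have := mulr_ge0_le0 t0 (sw a sa); lra.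
Qed.

(** A square parametrization, not an injective one: keeping the dimension fixed
    makes the restriction to a hyperplane a problem of literally the same type,
    also when a = 0. *)
Lemma hyperplane_param {R : realType} {k} (a : 'cV[R]_k) :
  exists K : 'M[R]_k, (forall u, dotmul a (K *m u) = 0) /\
    (forall d, dotmul a d = 0 -> exists u, d = K *m u).
Proof.
exists (kermx a)^T; split=> [u|d ad].
  by rewrite /dotmul mulmxA -trmx_mul mulmx_ker trmx0 mul0mx mxE.
have /sub_kermxP/submxP[D dE] : d^T *m a = 0.
  by apply/rowP => i; rewrite ord1 [RHS]mxE -[LHS]/(dotmul d a) dotmulC.
by exists D^T; rewrite -trmx_mul -dE trmxK.
Qed.

(** On ker B the quadratic is linear, so a lower bound makes c orthogonal to
    ker B; for symmetric B this means that c lies in the range of B and the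
    gradient c + B d has a zero. *)
Lemma quadobj_space_min {R : realType} {k} (c : 'cV[R]_k) (B : 'M[R]_k) l :
  psdmx B -> (forall d, l <= quadobj c B d) ->
  exists d, forall w, quadobj c B d <= quadobj c B w.
Proof.
move=> Bpsd lb; have Bsym := psdmx_tr _ Bpsd.
(* If c.d != 0, the quadratic takes the value l - 1 on the line spanned by d. *)
have cker d : B *m d = 0 -> dotmul c d = 0.
  move=> Bd; apply/eqP/negPn/negP => cd0.
  have := lb (((l - 1) / dotmul c d) *: d).
  rewrite /quadobj quadformE -scalemxAr Bd scaler0 dotmulZr divfK //.
  by rewrite /dotmul mulmx0 mxE mulr0; lra.
have /submxP[D cD] : (c^T <= B)%MS.
  rewrite submxE; move: (cokermx B) (mulmx_coker B) => K BK.
  apply/eqP/rowP => j; rewrite [RHS]mxE -(cker (K *m delta_mx j 0)).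
    by rewrite /dotmul mulmxA -colE [RHS]mxE.
  by rewrite mulmxA BK mul0mx.
have cE : c = B *m D^T by rewrite -[LHS]trmxK cD trmx_mul Bsym.
exists (- D^T) => w; rewrite -[in leRHS](subrK (- D^T) w) addrC quadobjD //.
rewrite mulmxN -cE subrr.
by rewrite /dotmul trmx0 mul0mx mxE addr0 lerDl mulr_ge0 // Bpsd.2.
Qed.

(** The infimum need not be approached on a bounded set, so compactness does not
    apply directly. Instead one inequality is dropped at a time: either the
    relaxed minimizer is feasible, or every point of the cone can be pushed,
    without increasing the quadratic, onto the face where that inequality is
    tight. *)
Lemma quadobj_polycone_min {R : realType} {k} (s : seq 'cV[R]_k)
    (c : 'cV[R]_k) (B : 'M[R]_k) l :
  psdmx B -> (forall d, polycone s d -> l <= quadobj c B d) ->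
  exists d, optimal_solution (polycone s) (quadobj c B) d.
Proof.
(* The face a.d = 0 is described by other normals, so the induction is on
   their number. *)
elim: {s}(size s) {-2}s (erefl (size s)) c B l => [|N IHN] [|a s] //=.
  move=> _ c B l Bpsd lb.
  have cone_nil (d : 'cV[R]_k) : polycone [::] d by [].
  have [d dmin] := quadobj_space_min c B l Bpsd (fun d => lb d (cone_nil d)).
  by exists d.
move=> [sN] c B l Bpsd lb.
have [[d [ad dopt]]|descent] : (exists d, dotmul a d <= 0 /\
      optimal_solution (polycone s) (quadobj c B) d) \/
    (forall x, polycone (a :: s) x -> exists y,
      [/\ polycone s y, 0 < dotmul a y & quadobj c B y <= quadobj c B x]).
  have [[l' lb']|unb] := pselect (exists l', forall d, polycone s d ->
      l' <= quadobj c B d).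
    have [d [sd dmin]] := IHN s sN c B l' Bpsd lb'.
    have [ad|ad] := leP (dotmul a d) 0; first by left; exists d.
    by right=> x /polycone_cons[_ /dmin xd]; exists d.
  (* q is unbounded below on the relaxed cone: one point with a value under l
     serves for every x, and it must violate the dropped inequality. *)
  right=> x ax.
  have [y /not_implyP[sy /negP]] :
      exists y, ~ (polycone s y -> l <= quadobj c B y).
    apply/not_existsP => H; apply: unb; exists l => d.
    exact: (contrapT (H d)).
  rewrite -ltNge => yl; exists y; split=> //.
    rewrite ltNge; apply/negP => ay.
    by have := lb y; rewrite leNgt yl => /(_ ltac:(exact/polycone_cons)).
  exact/ltW/(lt_le_trans yl)/lb.
- exists d; split; first exact/polycone_cons/(conj ad dopt.1).
  by move=> w /polycone_cons[_ /dopt.2].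
have [K [aK Kparam]] := hyperplane_param a.
pose s' := [seq K^T *m b | b <- s].
have s'E u : polycone s' u <-> polycone (a :: s) (K *m u).
  split=> [s'u|/polycone_cons[_ sKu] _ /mapP[b bs ->]].
    apply/polycone_cons; rewrite aK; split=> // b bs.
    by rewrite dotmulC dotmul_mulmxl dotmulC; apply: s'u; exact: map_f.
  by rewrite dotmul_mulmxl trmxK; exact: sKu.
have [||u [s'u umin]] := IHN s' (etrans (size_map _ _) sN) (K^T *m c)
    (K^T *m B *m K) l.
- exact: psdmx_congr.
- by move=> u /s'E/lb; rewrite quadobj_mulmx.
exists (K *m u); split=> [|x ax]; first exact/s'E.
have [y [sy ay yx]] := descent x ax.
have /polycone_cons[ax0 sx] := ax.
(* The parameter at which the segment from x to y crosses a.d = 0. *)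
pose t := - dotmul a x / (dotmul a y - dotmul a x).
have den0 : 0 < dotmul a y - dotmul a x by lra.
have t01 : 0 <= t <= 1.
  by rewrite divr_ge0 ?ler_pdivrMr ?mul1r ?lerDr ?oppr_ge0 // ltW.
have az : dotmul a (x + t *: (y - x)) = 0.
  by rewrite dotmulDr dotmulZr dotmulBr divfK ?subrr // gt_eqF.
have [v zv] := Kparam _ az.
apply: le_trans (quadobj_convex c B x y t Bpsd t01 yx).
rewrite zv !quadobj_mulmx; apply/umin/s'E; rewrite -zv.
by apply/polycone_cons; rewrite az; split=> //; exact: polycone_segment.
Qed.

(** * First-order conditions and Farkas' lemma *)

(** A cone contains d + t w for every w in it, which gives the inequality. It
    also contains d - t d for t <= 1, so both d and - d are directions of
    non-decrease and the gradient is orthogonal to d. *)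
Lemma quadobj_polycone_stationary {R : realType} {k} (s : seq 'cV[R]_k)
    (c : 'cV[R]_k) (B : 'M[R]_k) d :
  B^T = B -> optimal_solution (polycone s) (quadobj c B) d ->
  (forall w, polycone s w -> 0 <= dotmul (c + B *m d) w) /\
  dotmul (c + B *m d) d = 0.
Proof.
move=> Bsym [sd dmin].
have ge0 w : polycone s w -> 0 <= dotmul (c + B *m d) w.
  move=> sw; apply: quadobj_stationary => // t /andP[t0 _].
  by apply: dmin; apply: polycone_ray => //; exact: ltW.
split=> //; apply/eqP; rewrite eq_le ge0 // andbT -oppr_ge0 -dotmulNr.
apply: quadobj_stationary => // t /andP[t0 t1]; apply: dmin => a sa.
rewrite dotmulDr dotmulZr dotmulNr.
have : (1 - t) * dotmul a d <= 0 by rewrite mulr_ge0_le0 ?sd // subr_ge0.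
by lra.
Qed.

(** Minimize the squared norm of e = p + sum alpha_i a_i over alpha >= 0: the
    minimum is attained by the theorem above, being bounded below by 0. The
    first-order conditions say that e.a_i >= 0 for all i and that e is
    orthogonal to sum alpha_i a_i. So - e belongs to the dual cone, whence
    p.e <= 0, and e.e = p.e <= 0 forces e = 0. *)
Lemma farkas {R : realType} {k r} (a : 'I_r -> 'cV[R]_k) (p : 'cV[R]_k) :
  (forall w, (forall i, dotmul (a i) w <= 0) -> 0 <= dotmul p w) ->
  exists alpha : 'I_r -> R, (forall i, 0 <= alpha i) /\
    p + \sum_(i < r) alpha i *: a i = 0.
Proof.
move=> pdual.
pose M : 'M[R]_(k, r) := \matrix_(j, i) a i j 0.
pose s := [seq - delta_mx i 0 : 'cV[R]_r | i <- enum 'I_r].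
have sE v : polycone s v <-> forall i, 0 <= v i 0.
  split=> [sv i|v0 _ /mapP[i _ ->]]; last first.
    by rewrite dotmulC dotmulNr dotmul_delta oppr_le0.
  have := sv (- delta_mx i 0); rewrite dotmulC dotmulNr dotmul_delta oppr_le0.
  by apply; apply: map_f; rewrite mem_enum.
have distE v : quadobj (M^T *m p) (M^T *m M) v =
    2^-1 * dotmul (p + M *m v) (p + M *m v) - 2^-1 * dotmul p p.
  rewrite /quadobj quadformE dotmul_mulmxl trmxK -mulmxA -dotmul_mulmxl.
  by rewrite !dotmulDl !dotmulDr (dotmulC (M *m v) p); field.
have [v vopt] : exists v, optimal_solution (polycone s)
    (quadobj (M^T *m p) (M^T *m M)) v.
  apply: (@quadobj_polycone_min _ _ _ _ _ (- (2^-1 * dotmul p p))).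
    exact: psdmx_gram.
  by move=> d _; rewrite distE lerDr mulr_ge0 // dotmul_ge0.
have [+ +] :=
  quadobj_polycone_stationary _ _ _ _ (psdmx_tr _ (psdmx_gram M)) vopt.
rewrite -mulmxA -mulmxDr; set e := p + M *m v => ge0 eq0.
have ea i : 0 <= dotmul e (a i).
  have := ge0 (delta_mx i 0); rewrite dotmul_mulmxl trmxK -colE.
  rewrite (_ : col i M = a i); last by apply/colP => j; rewrite !mxE.
  by apply; apply/sE => j; rewrite mxE eqxx andbT ler0n.
have e0 : e = 0.
  apply: dotmul_le0_eq0; rewrite {2}/e dotmulDr.
  have := eq0; rewrite dotmul_mulmxl trmxK => ->; rewrite addr0.
  rewrite dotmulC -oppr_ge0 -dotmulNr; apply: pdual => i.
  by rewrite dotmulNr dotmulC oppr_le0.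
exists (fun i => v i 0); split; first exact/sE/vopt.1.
rewrite -[RHS]e0; congr (_ + _); apply/colP => j.
by rewrite summxE !mxE; apply: eq_bigr => i _; rewrite !mxE mulrC.
Qed.

(** * Gradients of convex functions *)
Lemma derive_dotmul_grad {R : realType} {k} (h : 'cV[R]_k -> R)
    (z d : 'cV[R]_k) :
  differentiable h z -> 'D_d h z = dotmul (grad h z) d.
Proof.
move=> hz; rewrite deriveE // {1}[d]matrix_sum_delta dotmulE linear_sum.
apply: eq_bigr => i _; rewrite big_ord1 linearZ /= mulrC mxE deriveE //.
Qed.

(** Convexity bounds the difference quotients at z in the direction w - z, for
    steps in ]0, 1], by h w - h z; let the step tend to 0 from the right. *)
Lemma convex_gradient_ineq {R : realType} {k} (h : 'cV[R]_k -> R)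
    (z w : 'cV[R]_k) :
  convex_function setT h -> differentiable h z ->
  dotmul (grad h z) (w - z) <= h w - h z.
Proof.
move=> hconv hz; rewrite -derive_dotmul_grad //.
have dh : derivable h z (w - z) by exact: diff_derivable.
rewrite /derive cvg_at_rightE //.
apply: limr_le.
  have /cvg_ex[l hl] := dh; apply/cvg_ex; exists l; apply: cvg_trans hl.
  apply: cvg_app.
  move=> A [e e0 Ae]; exists e => // x xe x0.
  by apply: Ae => //; exact: lt0r_neq0.
near=> t.
have t0 : 0 < t by near: t; exists 1 => /=.
have t1 : t <= 1.
  near: t; exists 1 => //= e; rewrite /= sub0r normrN => e1 _.
  exact/ltW/(le_lt_trans (ler_norm e)).
rewrite -[leLHS]/(t^-1 * (h (t *: (w - z) + z) - h z)).
rewrite ler_pdivrMl // lerBlDr.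
pose t' : {i01 R} := Itv01 (ltW t0) t1.
have := hconv t' w z (in_setT _) (in_setT _).
rewrite convRE /= /unstable.onem.
rewrite [X in h X <= _](_ : _ = t *: (w - z) + z); first by lra.
rewrite -[LHS]/(t *: w + (1 - t) *: z).
by rewrite scalerBr scalerBl scale1r -addrA (addrC z).
Unshelve. all: by end_near. Qed.

(** * Convertible nonconvex functions *)
Theorem theorem3p2 (R : realType) (n m r : nat) (r_ge1 : (1 <= r)%N)
  (f : 'cV[R]_n -> R) (g : 'cV[R]_(n + m) -> R)
  (gs : 'I_r -> 'cV[R]_(n + m) -> R)
  (B : 'cV[R]_(n + m) -> 'M[R]_(n + m))
  (g_diff2 : twice_differentiable g)
  (gs_diff2 : forall i : 'I_r, twice_differentiable (gs i))
  (f_wuCN : weak_uniform_CN f g gs B)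
  (xs : 'cV[R]_n) (ys : 'cV[R]_m) (xys_Xf : Xf f g gs (xs, ys))
  (G1_bounded : has_lbound
     [set G1 g B (col_mx xs ys) z | z in T1 gs (col_mx xs ys)]) :
  let zs := col_mx xs ys in
  (exists zbar : 'cV[R]_(n + m),
     optimal_solution (T1 gs zs) (G1 g B zs) zbar) /\
  (forall zbar : 'cV[R]_(n + m),
     optimal_solution (T1 gs zs) (G1 g B zs) zbar ->
     let dbar := zbar - zs in
     [/\ (0 <= G1 g B zs zbar ->
            optimal_solution (Xg gs) g zs /\ optimal_solution setT f xs),
         (G1 g B zs zbar < 0 ->
            G1 g B zs zbar = - (2^-1 * quadform (B zs) dbar))
       & ((exists z' : 'cV[R]_(n + m),
             forall i : 'I_r, dotmul (grad (gs i) zs) (z' - zs) < 0) ->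
          exists alpha : 'I_r -> R,
            (forall i : 'I_r, 0 <= alpha i) /\
            B zs *m dbar + grad g zs
              + \sum_(i < r) alpha i *: grad (gs i) zs = 0)]).
Proof.
move=> zs; have [[_ _ gs_conv f_min] g_wuc] := f_wuCN.
have [Bpsd g_lower] := g_wuc zs.
have Bsym := psdmx_tr _ Bpsd.
have [zs_Xg fxs] := xys_Xf; rewrite /= -/zs in zs_Xg fxs.
pose s := [seq grad (gs i) zs | i <- enum 'I_r].
have sE d : polycone s d <-> forall i, dotmul (grad (gs i) zs) d <= 0.
  split=> [sd i|sd _ /mapP[i _ ->] //].
  by apply: sd; apply: map_f; rewrite mem_enum.
have TE z : T1 gs zs z <-> polycone s (z - zs) by split=> /sE.
have optE z : optimal_solution (T1 gs zs) (G1 g B zs) z <->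
    optimal_solution (polycone s) (quadobj (grad g zs) (B zs)) (z - zs).
  split=> -[/TE Sz zmin]; split=> //.
    move=> w sw; have := zmin (w + zs); rewrite /G1 addrK; apply.
    by apply/TE; rewrite addrK.
  by move=> w /TE; exact: zmin.
split.
  have [l lb] := G1_bounded.
  have [d dopt] : exists d, optimal_solution (polycone s)
      (quadobj (grad g zs) (B zs)) d.
    apply: (@quadobj_polycone_min _ _ _ _ _ l) => // d sd; apply: lb.
    by exists (d + zs); [apply/TE; rewrite addrK | rewrite /G1 addrK].
  by exists (d + zs); apply/optE; rewrite addrK.
move=> z zopt dbar.
have [dge0 deq0] := quadobj_polycone_stationary _ _ _ _ Bsym ((optE z).1 zopt).
rewrite -/dbar in dge0 deq0.
split=> [G1_ge0|_|_].
- have zs_opt w : Xg gs w -> g zs <= g w.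
    move=> wX; rewrite -subr_ge0.
    have := g_lower (w - zs); rewrite (addrC zs) subrK; apply: le_trans.
    apply: (le_trans G1_ge0); apply: zopt.2 => i.
    have := convex_gradient_ineq (gs i) zs w (gs_conv i) ((gs_diff2 i).1 zs).
    by rewrite wX zs_Xg subrr.
  split; split=> // x _; rewrite fxs.
  by have [y [[yX _] ->]] := f_min x; exact: zs_opt.
- move: deq0; rewrite dotmulDl dotmul_mulmxl Bsym -quadformE /G1 -/dbar.
  by lra.
- have [|alpha [alpha0 E]] := farkas (fun i => grad (gs i) zs)
    (grad g zs + B zs *m dbar); first by move=> w aw; exact/dge0/sE.
  by exists alpha; split=> //; rewrite (addrC (B zs *m dbar)).
Qed.
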